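(* Consider the alternating algorithm (Algorithm 1) described in the context, started from any feasible $(\mathbf S_1^{(0)},\mathbf S_2^{(0)})$. The algorithm is convergent: the sequence of objective values $\tilde e_R(\mathbf T^{(k)},\mathbf S^{(k)})$ is non-increasing and converges, and the limit point $(\bar{\mathbf T}_R,\bar{\mathbf S}_1,\bar{\mathbf S}_2)$ of the iteration is a stationary point (satisfies the KKT conditions) of the problem $\min_{\mathbf T_R,\mathbf S_1,\mathbf S_2}\tilde e_R(\mathbf T_R,\mathbf S)$ subject to $\mathrm{Tr}(\mathbf S_i\mathbf S_i^H)\le\tau_i$, $i=1,2$.
   Context: MAC phase of a MIMO two-way relay system: sources with $N_1,N_2$ antennas, relay with $M$ antennas. Let $\mathbf Z_{t,H_i}\in\mathbb C^{N_i\times N_i}$, $\mathbf Z_{r,H}\in\mathbb C^{M\times M}$ be Hermitian positive definite with $\mathbf Z_{t,H_i}=\mathbf C_{t,H_i}\mathbf C_{t,H_i}^H$, $\mathbf Z_{r,H}=\mathbf C_{r,H}\mathbf C_{r,H}^H$, $\mathbf C_{t,H}=\mathrm{Blkdiag}(\mathbf C_{t,H_1},\mathbf C_{t,H_2})$. The relay receives $\mathbf Y_R=\mathbf H_1\mathbf S_1+\mathbf H_2\mathbf S_2+\mathbf N_R$ with $\mathbf H_i=\mathbf C_{r,H}\mathbf W_{H_i}\mathbf C_{t,H_i}^T$, $\mathbf W_{H_i}$ i.i.d. $\mathcal{CN}(0,1)$ entries, training $\mathbf S_i\in\mathbb C^{N_i\times L_S}$, $\mathbf S=[\mathbf S_1^T,\mathbf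 S_2^T]^T$, $\mathrm{vec}(\mathbf N_R)\sim\mathcal{CN}(\mathbf 0,\mathbf K_R)$, $\mathbf K_R=\mathbf K_{q,R}\otimes\mathbf K_{r,R}$ positive definite. Power limits $\tau_1,\tau_2>0$. Let $\mathbf F(\mathbf S)=\mathbf S^T\mathbf C_{t,H}\otimes\mathbf C_{r,H}$, $\mathbf C_{0,H}=\mathbf C_{t,H}^H\mathbf C_{t,H}\otimes\mathbf C_{r,H}^H\mathbf C_{r,H}$, and for $\mathbf T_R\in\mathbb C^{M(N_1+N_2)\times ML_S}$ define $\tilde e_R(\mathbf T_R,\mathbf S)=\mathrm{Tr}\big[\mathbf C_{0,H}\big(\mathbf I-\mathbf F^H\mathbf T_R^H-\mathbf T_R\mathbf F+\mathbf T_R\mathbf F\mathbf F^H\mathbf T_R^H+\mathbf T_R\mathbf K_R\mathbf T_R^H\big)\big]$ (the weighted MSE of the linear estimator $\mathbf T_R\,\mathrm{vec}(\mathbf Y_R)$ of $\mathrm{vec}([\mathbf W_{H_1},\mathbf W_{H_2}])$). Algorithm 1: initialize feasible $\mathbf S_1,\mathbf S_2$; repeat (a) set $\mathbf T_R=\mathbf F^H(\mathbf F\mathbf F^H+\mathbf K_R)^{-1}$ (LMMSE estimator for the current $\mathbf S$); (b) for this fixed $\mathbf T_R$, set $(\mathbf S_1,\mathbf S_2)$ to a global minimizer of $\tilde e_R(\mathbf T_R,\mathbf S)$ subject to $\mathrm{Tr}(\mathbf S_i\mathbf S_i^H)\le\tau_i$, $i=1,2$ (a convex quadratically constrained quadratic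 program); until the MSE decrease between iterations is below a threshold. *)

(* Defs.v *)
From HB Require Import structures.
From mathcomp Require Import all_boot all_order all_algebra.
From mathcomp Require Import complex mxtens.
From mathcomp Require Import all_classical all_reals all_analysis.

Set Implicit Arguments.
Unset Strict Implicit.
Unset Printing Implicit Defensive.

Import Order.TTheory GRing.Theory Num.Theory.
Import numFieldNormedType.Exports.
Local Open Scope ring_scope.

Section Defs.
Variable R : realType.
Local Notation C := (R[i]).

Definition hconj {m n : nat} (A : 'M[C]_(m, n)) : 'M[C]_(n, m) :=
  (map_mx (@conjc R) A)^T.

Definition herm_posdef {n : nat} (A : 'M[C]_n) : Prop :=
  hconj A = A /\
  forall x : 'cV[C]_n, x != 0 -> 0 < (hconj x *m A *m x) 0 0.

Definition Sstack {N1 N2 LS : nat} (S1 : 'M[C]_(N1, LS)) (S2 : 'M[C]_(N2, LS))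
  : 'M[C]_(N1 + N2, LS) := col_mx S1 S2.

Definition Ctblk {N1 N2 : nat} (Ct1 : 'M[C]_N1) (Ct2 : 'M[C]_N2) : 'M[C]_(N1 + N2) :=
  block_mx Ct1 0 0 Ct2.

Definition Fmx {N1 N2 M LS : nat} (Ct1 : 'M[C]_N1) (Ct2 : 'M[C]_N2) (Cr : 'M[C]_M)
  (S1 : 'M[C]_(N1, LS)) (S2 : 'M[C]_(N2, LS)) : 'M[C]_(LS * M, (N1 + N2) * M) :=
  ((Sstack S1 S2)^T *m Ctblk Ct1 Ct2) *t Cr.

Definition C0mx {N1 N2 M : nat} (Ct1 : 'M[C]_N1) (Ct2 : 'M[C]_N2) (Cr : 'M[C]_M)
  : 'M[C]_((N1 + N2) * M) :=
  (hconj (Ctblk Ct1 Ct2) *m Ctblk Ct1 Ct2) *t (hconj Cr *m Cr).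

Definition KRmx {M LS : nat} (Kq : 'M[C]_LS) (Kr : 'M[C]_M) : 'M[C]_(LS * M) :=
  Kq *t Kr.

Definition eR {N1 N2 M LS : nat} (Ct1 : 'M[C]_N1) (Ct2 : 'M[C]_N2) (Cr : 'M[C]_M)
  (Kq : 'M[C]_LS) (Kr : 'M[C]_M)
  (T : 'M[C]_((N1 + N2) * M, LS * M)) (S1 : 'M[C]_(N1, LS)) (S2 : 'M[C]_(N2, LS)) : C :=
  let F := Fmx Ct1 Ct2 Cr S1 S2 in
  let K := KRmx Kq Kr in
  \tr (C0mx Ct1 Ct2 Cr *m
        (1%:M - hconj F *m hconj T - T *m F
         + T *m F *m hconj F *m hconj T + T *m K *m hconj T)).

(** its real value (the trace above is real: Hermitian times Hermitian) *)
Definition eRr {N1 N2 M LS : nat} (Ct1 : 'M[C]_N1) (Ct2 : 'M[C]_N2) (Cr : 'M[C]_M)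
  (Kq : 'M[C]_LS) (Kr : 'M[C]_M)
  (T : 'M[C]_((N1 + N2) * M, LS * M)) (S1 : 'M[C]_(N1, LS)) (S2 : 'M[C]_(N2, LS)) : R :=
  complex.Re (eR Ct1 Ct2 Cr Kq Kr T S1 S2).

Definition Tlmmse {N1 N2 M LS : nat} (Ct1 : 'M[C]_N1) (Ct2 : 'M[C]_N2) (Cr : 'M[C]_M)
  (Kq : 'M[C]_LS) (Kr : 'M[C]_M)
  (S1 : 'M[C]_(N1, LS)) (S2 : 'M[C]_(N2, LS)) : 'M[C]_((N1 + N2) * M, LS * M) :=
  let F := Fmx Ct1 Ct2 Cr S1 S2 in
  hconj F *m invmx (F *m hconj F + KRmx Kq Kr).

Definition pow_tr {N LS : nat} (S : 'M[C]_(N, LS)) : R :=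
  complex.Re (\tr (S *m hconj S)).

Definition feasible {N1 N2 LS : nat} (tau1 tau2 : R)
  (S1 : 'M[C]_(N1, LS)) (S2 : 'M[C]_(N2, LS)) : Prop :=
  pow_tr S1 <= tau1 /\ pow_tr S2 <= tau2.

Definition fro2 {m n : nat} (A : 'M[C]_(m, n)) : R :=
  \sum_(i < m) \sum_(j < n) (complex.Re (A i j) ^+ 2 + complex.Im (A i j) ^+ 2).

Definition iterates_limit_point {N1 N2 M LS : nat}
  (Ts : nat -> 'M[C]_((N1 + N2) * M, LS * M))
  (S1s : nat -> 'M[C]_(N1, LS)) (S2s : nat -> 'M[C]_(N2, LS))
  (Tb : 'M[C]_((N1 + N2) * M, LS * M)) (S1b : 'M[C]_(N1, LS)) (S2b : 'M[C]_(N2, LS))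
  : Prop :=
  forall (eps : R), 0 < eps -> forall N : nat, exists k : nat,
    (N <= k)%N /\
    fro2 (Ts k - Tb) + fro2 (S1s k - S1b) + fro2 (S2s k - S2b) < eps.

(** KKT conditions of  min_{T,S1,S2} e~_R(T,S)  s.t.  Tr(S_i S_i^H) <= tau_i:
    primal feasibility, dual feasibility, complementary slackness, and
    stationarity of the (real-valued) Lagrangian, i.e. its derivative along
    every (complex) direction (dT, dS1, dS2) of the real parameter space
    vanishes (gradient of the Lagrangian = 0). *)
Definition KKT_point {N1 N2 M LS : nat} (Ct1 : 'M[C]_N1) (Ct2 : 'M[C]_N2) (Cr : 'M[C]_M)
  (Kq : 'M[C]_LS) (Kr : 'M[C]_M) (tau1 tau2 : R)
  (Tb : 'M[C]_((N1 + N2) * M, LS * M)) (S1b : 'M[C]_(N1, LS)) (S2b : 'M[C]_(N2, LS))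
  : Prop :=
  feasible tau1 tau2 S1b S2b /\
  exists mu1 mu2 : R,
    0 <= mu1 /\ 0 <= mu2 /\
    mu1 * (pow_tr S1b - tau1) = 0 /\ mu2 * (pow_tr S2b - tau2) = 0 /\
    forall (dT : 'M[C]_((N1 + N2) * M, LS * M)) (dS1 : 'M[C]_(N1, LS))
           (dS2 : 'M[C]_(N2, LS)),
      is_derive (0 : R) (1 : R)
        (fun t : R =>
           let T := Tb + (t%:C)%C *: dT in
           let S1 := S1b + (t%:C)%C *: dS1 in
           let S2 := S2b + (t%:C)%C *: dS2 in
           eRr Ct1 Ct2 Cr Kq Kr T S1 S2
           + mu1 * (pow_tr S1 - tau1) + mu2 * (pow_tr S2 - tau2))
        0.

End Defs.

(* Main.v *)
(** With [G = C_t (x) C_r] the objective is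
    [|G (1 - T F)|^2 + Tr (G T K T^H G^H)]. Completing the square in [T], the
    LMMSE estimator minimises it for fixed [S], so both half-steps decrease a
    nonnegative quantity. At a limit point, the normal equations for [T] pass to the limit and
    make the [T]-derivative vanish; and since
    [e(T_k, S) >= e(T_k, S_(k+1)) >= e(T_(k+1), S_(k+1)) >= e(Tb, Sb)] for every
    feasible [S], [Sb] is a global minimiser of [e(Tb, .)]. The constraints being
    balls of positive radius, one for each block, first-order optimality in each
    block yields its multiplier. *)

Require Import Defs.
From HB Require Import structures.
From mathcomp Require Import all_boot all_order all_algebra.
From mathcomp Require Import complex mxtens.
From mathcomp Require Import all_classical all_reals all_analysis.
From mathcomp Require Import ring lra.
Import Order.TTheory GRing.Theory Num.Theory.
Import numFieldNormedType.Exports.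
Local Open Scope classical_set_scope.
Local Open Scope ring_scope.
Set Implicit Arguments.
Unset Strict Implicit.
Unset Printing Implicit Defensive.

(* Locked, since otherwise [ring] unfolds it when comparing atoms. *)
HB.lock Definition rdot (R : realType) m n (X Y : 'M[R[i]]_(m, n)) : R :=
  complex.Re (\tr (X *m hconj Y)).

(** * Complex matrices, conjugate transpose and the real trace inner product *)

Section ComplexMatrices.
Variable R : realType.
Local Notation C := (R[i]).
Local Notation Re := complex.Re.
Local Notation Im := complex.Im.

Lemma ReD (x y : C) : Re (x + y) = Re x + Re y.
Proof. by case: x; case: y. Qed.

Lemma ImD (x y : C) : Im (x + y) = Im x + Im y.
Proof. by case: x; case: y. Qed.

Lemma ReM (x y : C) : Re (x * y) = Re x * Re y - Im x * Im y.
Proof. by case: x; case: y. Qed.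

Lemma ImM (x y : C) : Im (x * y) = Re x * Im y + Im x * Re y.
Proof. by case: x; case: y. Qed.

Lemma Re_conjc (x : C) : Re (conjc x) = Re x.
Proof. by case: x. Qed.

Lemma Im_conjc (x : C) : Im (conjc x) = - Im x.
Proof. by case: x. Qed.

Lemma Re_sum I r (P : pred I) (F : I -> C) :
  Re (\sum_(i <- r | P i) F i) = \sum_(i <- r | P i) Re (F i).
Proof. exact: (big_morph _ ReD (erefl _)). Qed.

Lemma hconjE m n (A : 'M[C]_(m, n)) i j : hconj A i j = conjc (A j i).
Proof. by rewrite !mxE. Qed.

Lemma hconjK m n (A : 'M[C]_(m, n)) : hconj (hconj A) = A.
Proof. by apply/matrixP => i j; rewrite !hconjE conjcK. Qed.

Lemma hconjM m n p (A : 'M[C]_(m, n)) (B : 'M[C]_(n, p)) :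
  hconj (A *m B) = hconj B *m hconj A.
Proof. by rewrite /hconj map_mxM trmx_mul. Qed.

Lemma hconjB m n (A B : 'M[C]_(m, n)) : hconj (A - B) = hconj A - hconj B.
Proof. by apply/matrixP => i j; rewrite !mxE rmorphB. Qed.

Lemma hconj1 n : hconj (1%:M : 'M[C]_n) = 1%:M.
Proof. by rewrite /hconj map_mx1 trmx1. Qed.

Lemma hconj_tens m n p q (A : 'M[C]_(m, n)) (B : 'M[C]_(p, q)) :
  hconj (A *t B) = hconj A *t hconj B.
Proof. by rewrite /hconj map_mxT trmx_tens. Qed.

Lemma rdotC m n (X Y : 'M[C]_(m, n)) : rdot X Y = rdot Y X.
Proof.
rewrite rdot.unlock; have -> : Y *m hconj X = hconj (X *m hconj Y).
  by rewrite hconjM hconjK.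
by rewrite [in RHS]/hconj mxtrace_tr trace_map_mx Re_conjc.
Qed.

Lemma rdotDl m n (X Y Z : 'M[C]_(m, n)) : rdot (X + Y) Z = rdot X Z + rdot Y Z.
Proof. by rewrite rdot.unlock mulmxDl mxtraceD ReD. Qed.

Lemma rdotDr m n (X Y Z : 'M[C]_(m, n)) : rdot X (Y + Z) = rdot X Y + rdot X Z.
Proof. by rewrite rdotC rdotDl !(rdotC X). Qed.

Lemma rdotZl m n (t : R) (X Y : 'M[C]_(m, n)) :
  rdot (t%:C%C *: X) Y = t * rdot X Y.
Proof. by rewrite rdot.unlock -scalemxAl mxtraceZ ReM /= mul0r subr0. Qed.

Lemma rdotZr m n (t : R) (X Y : 'M[C]_(m, n)) :
  rdot X (t%:C%C *: Y) = t * rdot X Y.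
Proof. by rewrite rdotC rdotZl rdotC. Qed.

Lemma rdotNl m n (X Y : 'M[C]_(m, n)) : rdot (- X) Y = - rdot X Y.
Proof. by rewrite -scaleN1r -(rmorphN1 (real_complex R)) rdotZl mulN1r. Qed.

Lemma rdotNr m n (X Y : 'M[C]_(m, n)) : rdot X (- Y) = - rdot X Y.
Proof. by rewrite rdotC rdotNl rdotC. Qed.

Lemma rdot_mulr m n p (X : 'M[C]_(m, p)) (Y : 'M[C]_(m, n)) (F : 'M[C]_(n, p)) :
  rdot X (Y *m F) = rdot (X *m hconj F) Y.
Proof. by rewrite rdot.unlock hconjM mulmxA. Qed.

Lemma rdot_sqrB m n (X Y : 'M[C]_(m, n)) :
  rdot (X - Y) (X - Y) = rdot X X - 2 * rdot X Y + rdot Y Y.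
Proof. rewrite !(rdotDl, rdotDr, rdotNl, rdotNr) (rdotC Y X); ring. Qed.

Lemma rdot_fro2 m n (X : 'M[C]_(m, n)) : rdot X X = fro2 X.
Proof.
rewrite rdot.unlock /fro2 /mxtrace Re_sum; apply: eq_bigr => i _.
rewrite mxE Re_sum; apply: eq_bigr => j _.
by rewrite hconjE ReM Re_conjc Im_conjc mulrN opprK !expr2.
Qed.

Lemma fro2_ge0 m n (X : 'M[C]_(m, n)) : 0 <= fro2 X.
Proof. by do 2 apply: sumr_ge0 => ? _; rewrite addr_ge0 ?sqr_ge0. Qed.

Lemma entry_le_fro2 m n (X : 'M[C]_(m, n)) i j :
  Re (X i j) ^+ 2 + Im (X i j) ^+ 2 <= fro2 X.
Proof.
rewrite /fro2 (bigD1 i) //= (bigD1 j) //= -addrA lerDl addr_ge0 //.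
  by apply: sumr_ge0 => ? _; rewrite addr_ge0 ?sqr_ge0.
by do 2 apply: sumr_ge0 => ? _; rewrite addr_ge0 ?sqr_ge0.
Qed.

Lemma rdot_ge0 m n (X : 'M[C]_(m, n)) : 0 <= rdot X X.
Proof. by rewrite rdot_fro2 fro2_ge0. Qed.

(** The diagonal entries of X K X^H are values of the quadratic form of [K], taken at the conjugated
    rows of [X]. *)
Lemma herm_posdef_rdot_ge0 m n (K : 'M[C]_n) (X : 'M[C]_(m, n)) :
  herm_posdef K -> 0 <= rdot (X *m K) X.
Proof.
move=> [_ Kpos]; rewrite rdot.unlock /mxtrace Re_sum; apply: sumr_ge0 => i _.
have -> : (X *m K *m hconj X) i i =
    (hconj (hconj (row i X)) *m K *m hconj (row i X)) 0 0.
  rewrite hconjK !mxE; apply: eq_bigr => j _; rewrite !mxE; congr (_ * _).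
  by apply: eq_bigr => l _; rewrite !mxE.
have [-> | /Kpos] := eqVneq (hconj (row i X)) 0; first by rewrite mulmx0 mxE.
by case: (_ 0 0) => a b; rewrite ltcE /= => /andP[_ /ltW].
Qed.

Lemma rdot_herm m n (K : 'M[C]_n) (X Y : 'M[C]_(m, n)) :
  hconj K = K -> rdot (X *m K) Y = rdot (Y *m K) X.
Proof. by move=> Kh; rewrite rdotC rdot_mulr Kh. Qed.

(** A nonzero row [v] with v (F F^H + K) = 0 would give v K v^H = - |v F|^2 <= 0, against the
    positivity of [K]. *)
Lemma gram_add_posdef_unit m n (F : 'M[C]_(m, n)) (K : 'M[C]_m) :
  herm_posdef K -> F *m hconj F + K \in unitmx.
Proof.
move=> Kpd; rewrite unitmxE unitfE; apply/negP => /det0P[v v0 vA].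
have := Kpd.2 (hconj v); rewrite hconjK.
have vH0 : hconj v != 0.
  apply: contra v0 => /eqP vH; rewrite -(hconjK v) vH.
  by apply/eqP/matrixP => i j; rewrite hconjE !mxE conjc0.
move=> /(_ vH0); have -> : v *m K = - (v *m F *m hconj F).
  by apply/eqP; rewrite -addr_eq0 addrC -mulmxA -mulmxDr vA.
rewrite mulNmx mxE -(mulmxA (v *m F)) -hconjM.
have := fro2_ge0 (v *m F); rewrite -rdot_fro2 rdot.unlock /mxtrace big_ord1.
case: (_ 0 0) => a b /= a0; rewrite ltcE /= oppr_gt0 => /andP[_].
by rewrite ltNge a0.
Qed.

(** * The weighted mean square error as a function of estimator and channel matrix *)

Section MeanSquareError.
Variables p q : nat.
Variables (G : 'M[C]_p) (K : 'M[C]_q).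
Implicit Types (T : 'M[C]_(p, q)) (F : 'M[C]_(q, p)).

(** Taking [F] itself as the variable keeps the Kronecker structure out of the calculus; the
    training matrices enter only through [Fmx], which is linear in them. *)
Definition mse T F : R :=
  rdot (G *m (1%:M - T *m F)) (G *m (1%:M - T *m F)) +
  rdot (G *m T *m K) (G *m T).

Hypothesis Kpd : herm_posdef K.

Lemma mse_ge0 T F : 0 <= mse T F.
Proof. by rewrite addr_ge0 ?rdot_ge0 ?herm_posdef_rdot_ge0. Qed.

(* The normal equations say that the estimation error is orthogonal to the
   data, so both cross terms of a perturbation of [T] cancel. *)
Lemma lmmse_orthogonality T F (D : 'M[C]_(p, q)) :
  T *m (F *m hconj F + K) = hconj F ->
  rdot (G *m (1%:M - T *m F)) (G *m D *m F) = rdot (G *m T *m K) (G *m D).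
Proof.
move=> TA; rewrite rdot_mulr -(mulmxA G T) -(mulmxA G); congr (rdot (G *m _) _).
by rewrite mulmxBl mul1mx -{1}TA mulmxDr -(mulmxA T) addrAC subrr add0r.
Qed.

Lemma lmmse_min T T' F :
  T *m (F *m hconj F + K) = hconj F -> mse T F <= mse T' F.
Proof.
move=> TA; set D := T' - T.
have -> : T' = T + D by rewrite addrC subrK.
have := lmmse_orthogonality D TA.
have := rdot_ge0 (G *m D *m F).
have := herm_posdef_rdot_ge0 (G *m D) Kpd.
rewrite /mse; have -> : G *m (1%:M - (T + D) *m F) =
    G *m (1%:M - T *m F) - G *m D *m F.
  by rewrite mulmxDl opprD addrA mulmxBr (mulmxA G D).
rewrite (mulmxDr G T) mulmxDl.
rewrite rdot_sqrB (rdotDl (G *m T *m K)) !(rdotDr _ (G *m T)).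
rewrite (rdot_herm (G *m D) (G *m T) Kpd.1) => DK0 DF0 ->.
rewrite -subr_ge0 [X in 0 <= X](_ : _ = rdot (G *m D *m F) (G *m D *m F) +
  rdot (G *m D *m K) (G *m D)); first exact: addr_ge0.
ring.
Qed.

Lemma mse_line_F T F (dF : 'M[C]_(q, p)) (t : R) :
  mse T (F + t%:C%C *: dF) = mse T F
   - 2 * rdot (G *m (1%:M - T *m F)) (G *m T *m dF) * t
   + rdot (G *m T *m dF) (G *m T *m dF) * t ^+ 2.
Proof.
rewrite /mse; have -> : G *m (1%:M - T *m (F + t%:C%C *: dF)) =
    G *m (1%:M - T *m F) - t%:C%C *: (G *m T *m dF).
  by rewrite (mulmxDr T) opprD addrA mulmxBr -!scalemxAr mulmxA.
rewrite rdot_sqrB rdotZl !rdotZr; ring.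
Qed.

(** Along a joint line the error is a quartic in [t], so its derivative can be computed formally.
    The normal equations remove the first-order effect of [dT], and only [dF] contributes to the
    slope. *)
Lemma mse_line T F (dT : 'M[C]_(p, q)) (dF : 'M[C]_(q, p)) :
  T *m (F *m hconj F + K) = hconj F ->
  exists P : {poly R},
    P^`().[0] = - 2 * rdot (G *m (1%:M - T *m F)) (G *m T *m dF) /\
    forall t : R, mse (T + t%:C%C *: dT) (F + t%:C%C *: dF) = P.[t].
Proof.
move=> TA.
pose E := G *m (1%:M - T *m F).
pose X := G *m T *m dF; pose Y := G *m dT *m F; pose Z := G *m dT *m dF.
pose c0 := mse T F.
pose c1 : R := - 2 * rdot E X.
pose c2 := rdot X X + rdot Y Y + 2 * rdot X Y - 2 * rdot E Z +
  rdot (G *m dT *m K) (G *m dT).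
pose c3 := 2 * rdot X Z + 2 * rdot Y Z.
pose c4 := rdot Z Z.
exists (c0%:P + c1%:P * 'X + c2%:P * 'X ^+ 2 + c3%:P * 'X ^+ 3 +
  c4%:P * 'X ^+ 4).
split.
  by rewrite !poly.derivE !hornerE /= -/E -/X /c1; ring.
move=> t.
have Yc := lmmse_orthogonality dT TA.
rewrite !(hornerD, hornerM, hornerC, hornerXn, hornerX) /mse.
have -> : G *m (1%:M - (T + t%:C%C *: dT) *m (F + t%:C%C *: dF)) =
    E - t%:C%C *: X - t%:C%C *: Y - t%:C%C *: (t%:C%C *: Z).
  have -> : (T + t%:C%C *: dT) *m (F + t%:C%C *: dF) = T *m F +
      t%:C%C *: (T *m dF) + t%:C%C *: (dT *m F) +
      t%:C%C *: (t%:C%C *: (dT *m dF)).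
    by rewrite mulmxDl !mulmxDr -!scalemxAr -!scalemxAl addrA.
  by rewrite /E /X /Y /Z !opprD !addrA !mulmxBr -!scalemxAr !mulmxA.
(* Orthogonality rewrites the linear part of the noise term as 2 <E, Y> t, which cancels the -2 <E,
   Y> t coming from the squared error. *)
have -> : rdot (G *m (T + t%:C%C *: dT) *m K) (G *m (T + t%:C%C *: dT)) =
    rdot (G *m T *m K) (G *m T) + 2 * rdot E Y * t +
    rdot (G *m dT *m K) (G *m dT) * t ^+ 2.
  rewrite (mulmxDr G T) mulmxDl -scalemxAr -scalemxAl rdotDl !rdotDr rdotZl.
  rewrite !rdotZr rdotZl (rdot_herm (G *m dT) (G *m T) Kpd.1) -Yc -/E -/Y; ring.
rewrite /c0 /c1 /c2 /c3 /c4 /mse -/E.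
clear c0 c1 c2 c3 c4 Yc.
move: E X Y Z (rdot (G *m T *m K) _) (rdot (G *m dT *m K) _) => E X Y Z a b.
rewrite !(rdotDl, rdotDr, rdotNl, rdotNr, rdotZl, rdotZr).
rewrite (rdotC X E) (rdotC Y E) (rdotC Z E) (rdotC Y X) (rdotC Z X) (rdotC Z Y).
ring.
Qed.

End MeanSquareError.

(** * First-order optimality on a ball *)

Lemma pow_trE m n (S : 'M[C]_(m, n)) : pow_tr S = rdot S S.
Proof. by rewrite rdot.unlock. Qed.

Lemma ge0_of_small_quadratic (c e t0 : R) : 0 < t0 ->
  (forall t, 0 < t <= t0 -> 0 <= c * t + e * t ^+ 2) -> 0 <= c.
Proof.
move=> t0_gt0 H; rewrite leNgt; apply/negP => c0.
(* The step [t] is small enough that e t <= b t <= -c/2, so c + e t <= c/2 < 0. *)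
pose b := 1 + `|e|; have b0 : 0 < b by rewrite ltr_pwDl.
pose t := Num.min t0 (- c / (2 * b)).
have t_gt0 : 0 < t by rewrite lt_min t0_gt0 divr_gt0 ?oppr_gt0 ?mulr_gt0.
have /H : 0 < t <= t0 by rewrite t_gt0 ge_min lexx.
have tb : t * (2 * b) <= - c.
  by rewrite -ler_pdivlMr ?mulr_gt0 // ge_min lexx orbT.
have eb : e <= b by rewrite (le_trans (ler_norm e)) // lerDr.
apply/negP; rewrite -ltNge expr2 mulrA -mulrDl pmulr_llt0 //.
have : e * t <= b * t by rewrite ler_pM2r.
by lra.
Qed.

(** Here p = |S|^2, a = <S, d> and q = |d|^2, so the polynomial is |S + t d|^2. A short step stays
    in the ball if there is slack, or if [d] points strictly inward. *)
Lemma ball_step (tau p a q : R) : 0 <= q -> p <= tau -> (p < tau \/ a < 0) ->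
  exists2 t0 : R, 0 < t0 &
    forall t, 0 < t <= t0 -> p + 2 * a * t + q * t ^+ 2 <= tau.
Proof.
move=> q0 pt [ptau|a0].
  (* For t <= 1 one has t^2 <= t, so the growth is at most b t; the summand 1 keeps [b] positive. *)
  pose b := 1 + 2 * `|a| + q.
  have b0 : 0 < b by rewrite /b; have := normr_ge0 a; lra.
  exists (Num.min 1 ((tau - p) / b)).
    by rewrite lt_min ltr01 divr_gt0 ?subr_gt0.
  move=> t /andP[t0]; rewrite le_min ler_pdivlMr // => /andP[t1 tb].
  have : a * t <= `|a| * t by rewrite ler_pM2r // ler_norm.
  have : q * t ^+ 2 <= q * t by rewrite ler_wpM2l // expr2 ler_piMl // ltW.
  move: tb; rewrite /b !mulrDr; nra.
(* Up to this bound 2 a + q t <= - t <= 0, so the norm does not grow; q + 1 avoids dividing by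
   zero. *)
exists (- 2 * a / (q + 1)); first by rewrite divr_gt0 //; lra.
move=> t /andP[t0]; rewrite ler_pdivlMr; last by lra.
by nra.
Qed.

(* On the boundary, [D] is nonnegative on the open half-space [<S, d> < 0],
   hence a nonpositive multiple of [<S, .>]; [mu] is read off at [d = S]. *)
Lemma ball_multiplier m n (S : 'M[C]_(m, n)) (tau : R)
    (D e : 'M[C]_(m, n) -> R) :
  0 < tau -> pow_tr S <= tau ->
  (forall x y, D (x + y) = D x + D y) ->
  (forall t x, D (t%:C%C *: x) = t * D x) ->
  (forall d t, pow_tr (S + t%:C%C *: d) <= tau ->
    0 <= D d * t + e d * t ^+ 2) ->
  exists mu : R, [/\ 0 <= mu, mu * (pow_tr S - tau) = 0 &
    forall d, D d + 2 * mu * rdot S d = 0].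
Proof.
move=> tau0 Stau DD DZ Dmin.
have Dge0 d : pow_tr S < tau \/ rdot S d < 0 -> 0 <= D d.
  move=> /(ball_step (rdot_ge0 d) Stau)[t0 t0_gt0 ht].
  apply: (ge0_of_small_quadratic t0_gt0) => t /ht {}ht; apply: (Dmin d).
  rewrite pow_trE !(rdotDl, rdotDr, rdotZl, rdotZr) (rdotC d S) -pow_trE.
  by apply: le_trans ht; rewrite le_eqVlt; apply/orP; left; apply/eqP; ring.
have DN d : D (- d) = - D d.
  by rewrite -scaleN1r -(rmorphN1 (real_complex R)) DZ mulN1r.
move: Stau; rewrite le_eqVlt => /orP[/eqP Stau|Stau]; last first.
  (* In the interior both [d] and [- d] are admissible, so [D] vanishes and the multiplier is
     zero. *)
  exists 0; split => // [|d]; first by rewrite mul0r.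
  rewrite mulr0 mul0r addr0; apply/eqP; rewrite eq_le Dge0 ?andbT; last by left.
  by rewrite -oppr_ge0 -DN Dge0 //; left.
rewrite pow_trE in Stau.
have DS : D S <= 0 by rewrite -oppr_ge0 -DN Dge0 // rdotNr Stau oppr_lt0; right.
(* A tangent direction is tilted inward to d - t S, where [D] is nonnegative; then [t] tends to
   0. *)
have Dorth d : rdot S d = 0 -> 0 <= D d.
  move=> Sd; apply: (@ge0_of_small_quadratic _ (- D S) 1) => // t /andP[t0 _].
  have : 0 <= D (d + (- t)%:C%C *: S).
    apply: Dge0; right.
    by rewrite rdotDr rdotZr Sd Stau add0r mulNr oppr_lt0 mulr_gt0.
  by rewrite DD DZ mulNr mulNr => H; have := mulr_ge0 (ltW t0) H; lra.
exists (- D S / (2 * tau)); split.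
- by rewrite divr_ge0 ?oppr_ge0 // mulr_ge0 // ltW.
- by rewrite pow_trE Stau subrr mulr0.
(* [d'] is the projection of [d] onto the orthogonal complement of [S]; there [Dorth], applied to
   [d'] and [- d'], makes [D] vanish. *)
move=> d; pose s := rdot S d / tau.
pose d' := d + (- s)%:C%C *: S.
have d'0 : rdot S d' = 0.
  by rewrite /d' rdotDr rdotZr Stau /s mulNr divfK ?subrr // gt_eqF.
have : D d' = 0.
  apply/eqP; rewrite eq_le Dorth // andbT -oppr_ge0 -DN Dorth //.
  by rewrite rdotNr d'0 oppr0.
rewrite /d' DD DZ /s => H; have -> : D d = rdot S d / tau * D S by lra.
by field; rewrite gt_eqF.
Qed.

(** * Entrywise convergence of complex matrices, through real limits *)

Definition ccvg (u : nat -> C) (a : C) : Prop :=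
  (Re (u k) @[k --> \oo] --> Re a) /\ (Im (u k) @[k --> \oo] --> Im a).

Lemma ccvg_cst a : ccvg (fun=> a) a.
Proof. by split; exact: cvg_cst. Qed.

Lemma ccvgD u v a b : ccvg u a -> ccvg v b -> ccvg (fun k => u k + v k) (a + b).
Proof.
move=> [ua1 ua2] [vb1 vb2]; split.
  by rewrite ReD; under eq_fun do rewrite ReD; exact: cvgD.
by rewrite ImD; under eq_fun do rewrite ImD; exact: cvgD.
Qed.

Lemma ccvgM u v a b : ccvg u a -> ccvg v b -> ccvg (fun k => u k * v k) (a * b).
Proof.
move=> [ua1 ua2] [vb1 vb2]; split.
  rewrite ReM; under eq_fun do rewrite ReM.
  by apply: cvgB; exact: cvgM.
rewrite ImM; under eq_fun do rewrite ImM.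
by apply: cvgD; exact: cvgM.
Qed.

Lemma ccvg_conjc u a : ccvg u a -> ccvg (fun k => conjc (u k)) (conjc a).
Proof.
move=> [ua1 ua2]; split.
  by rewrite Re_conjc; under eq_fun do rewrite Re_conjc.
by rewrite Im_conjc; under eq_fun do rewrite Im_conjc; exact: cvgN.
Qed.

Lemma ccvg_sum n (u : 'I_n -> nat -> C) (a : 'I_n -> C) :
  (forall i, ccvg (u i) (a i)) ->
  ccvg (fun k => \sum_(i < n) u i k) (\sum_(i < n) a i).
Proof.
move=> ua; elim: n u a ua => [|n IH] u a ua.
  by rewrite big_ord0; under eq_fun do rewrite big_ord0; exact: ccvg_cst.
rewrite big_ord_recl; under eq_fun do rewrite big_ord_recl.
by apply: ccvgD => //; apply: IH.
Qed.

Definition mcvg m n (u : nat -> 'M[C]_(m, n)) (a : 'M[C]_(m, n)) : Prop :=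
  forall i j, ccvg (fun k => u k i j) (a i j).

Lemma mcvg_cst m n (a : 'M[C]_(m, n)) : mcvg (fun=> a) a.
Proof. by move=> i j; exact: ccvg_cst. Qed.

Lemma mcvgD m n (u v : nat -> 'M[C]_(m, n)) a b :
  mcvg u a -> mcvg v b -> mcvg (fun k => u k + v k) (a + b).
Proof.
by move=> ua vb i j; rewrite mxE; under eq_fun do rewrite mxE; exact: ccvgD.
Qed.

Lemma mcvgM m n p (u : nat -> 'M[C]_(m, n)) (v : nat -> 'M[C]_(n, p)) a b :
  mcvg u a -> mcvg v b -> mcvg (fun k => u k *m v k) (a *m b).
Proof.
move=> ua vb i j; rewrite mxE; under eq_fun do rewrite mxE.
by apply: ccvg_sum => l; exact: ccvgM.
Qed.

Lemma mcvgN m n (u : nat -> 'M[C]_(m, n)) a :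
  mcvg u a -> mcvg (fun k => - u k) (- a).
Proof.
move=> ua i j; rewrite mxE -mulN1r; under eq_fun do rewrite mxE -mulN1r.
by apply: ccvgM => //; exact: ccvg_cst.
Qed.

Lemma mcvg_hconj m n (u : nat -> 'M[C]_(m, n)) a :
  mcvg u a -> mcvg (fun k => hconj (u k)) (hconj a).
Proof.
move=> ua i j; rewrite hconjE; under eq_fun do rewrite hconjE.
exact: ccvg_conjc.
Qed.

Lemma mcvg_unique m n (u : nat -> 'M[C]_(m, n)) a b :
  mcvg u a -> mcvg u b -> a = b.
Proof.
move=> ua ub; apply/matrixP => i j.
have [/cvg_lim a1 /cvg_lim a2] := ua i j.
have [/cvg_lim b1 /cvg_lim b2] := ub i j.
apply/eqP; rewrite eq_complex -a1 // -a2 // -b1 // -b2 //.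
by rewrite !eqxx.
Qed.

Lemma cvg_rdot m n (u v : nat -> 'M[C]_(m, n)) a b :
  mcvg u a -> mcvg v b -> rdot (u k) (v k) @[k --> \oo] --> rdot a b.
Proof.
move=> ua vb; rewrite rdot.unlock /mxtrace.
have uv := mcvgM ua (mcvg_hconj vb).
by have [] := ccvg_sum (fun i => uv i i).
Qed.

(** [fro2] is a squared norm, so the squared bound puts each real and imaginary part within 1/(k+1)
    of its limit. *)
Lemma mcvg_fro2 m n (u : nat -> 'M[C]_(m, n)) a :
  (forall k, fro2 (u k - a) <= harmonic k ^+ 2) -> mcvg u a.
Proof.
move=> ua i j.
(* [f] stands for the real or the imaginary part; additivity is all the argument needs. *)
have H (f : C -> R) : (forall x y, f (x + y) = f x + f y) ->
    (forall k, f ((u k - a) i j) ^+ 2 <= harmonic k ^+ 2) ->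
    f (u k i j) @[k --> \oo] --> f (a i j).
  move=> fD fu.
  have fuk k : f (u k i j) = f ((u k - a) i j) + f (a i j).
    by rewrite -fD !mxE subrK.
  rewrite -[X in _ --> X]add0r; under eq_fun do rewrite fuk.
  apply: cvgD; last exact: cvg_cst.
  have hN : - (@harmonic R) k @[k --> \oo] --> (0 : R).
    by rewrite -oppr0; apply: cvgN; exact: cvg_harmonic.
  apply: (squeeze_cvgr _ hN cvg_harmonic); apply: nearW => k.
  rewrite -ler_norml -(@ler_pXn2r R 2) ?nnegrE ?normr_ge0 ?harmonic_ge0 //.
  by rewrite real_normK ?num_real.
by split; apply: H => [|k]; (exact: ReD || exact: ImD ||
  (apply: le_trans (ua k); apply: le_trans (entry_le_fro2 _ i j);
   rewrite ?lerDl ?lerDr sqr_ge0)).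
Qed.

Lemma cvg_mse p q (G : 'M[C]_p) (K : 'M[C]_q) u v a b : mcvg u a -> mcvg v b ->
  mse G K (u k) (v k) @[k --> \oo] --> mse G K a b.
Proof.
move=> ua vb.
have h1 : mcvg (fun k => G *m (1%:M - u k *m v k)) (G *m (1%:M - a *m b)).
  apply: mcvgM; first exact: mcvg_cst.
  by apply: mcvgD; [exact: mcvg_cst | apply: mcvgN; exact: mcvgM].
have h2 : mcvg (fun k => G *m u k) (G *m a).
  by apply: mcvgM => //; exact: mcvg_cst.
apply: cvgD; apply: cvg_rdot => //.
by apply: mcvgM => //; exact: mcvg_cst.
Qed.

End ComplexMatrices.

(** * The relay objective and its KKT conditions *)

Section TwoWayRelay.
Variable R : realType.
Local Notation C := (R[i]).
Variables (N1 N2 M LS : nat).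
Variables (Ct1 : 'M[C]_N1) (Ct2 : 'M[C]_N2) (Cr : 'M[C]_M).
Variables (Kq : 'M[C]_LS) (Kr : 'M[C]_M).

Local Notation F := (Fmx Ct1 Ct2 Cr).
Local Notation K := (KRmx Kq Kr).
Local Notation G := (Ctblk Ct1 Ct2 *t Cr).
Local Notation err := (mse G K).

Lemma Fmx_line (c : C) (S1 D1 : 'M[C]_(N1, LS)) (S2 D2 : 'M[C]_(N2, LS)) :
  F (S1 + c *: D1) (S2 + c *: D2) = F S1 S2 + c *: F D1 D2.
Proof.
rewrite /Fmx; have -> : Sstack (S1 + c *: D1) (S2 + c *: D2) =
    Sstack S1 S2 + c *: Sstack D1 D2.
  by rewrite /Sstack scale_col_mx add_col_mx.
rewrite linearD linearZ /= mulmxDl -scalemxAl.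
by apply/matrixP => i j; rewrite !mxE mulrDl mulrA.
Qed.

Lemma Fmx_linel (c : C) (S1 D1 : 'M[C]_(N1, LS)) (S2 : 'M[C]_(N2, LS)) :
  F (S1 + c *: D1) S2 = F S1 S2 + c *: F D1 0.
Proof. by rewrite -Fmx_line scaler0 addr0. Qed.

Lemma Fmx_liner (c : C) (S1 : 'M[C]_(N1, LS)) (S2 D2 : 'M[C]_(N2, LS)) :
  F S1 (S2 + c *: D2) = F S1 S2 + c *: F 0 D2.
Proof. by rewrite -Fmx_line scaler0 addr0. Qed.

Lemma Fmx0 : F (0 : 'M[C]_(N1, LS)) (0 : 'M[C]_(N2, LS)) = 0.
Proof. by rewrite /Fmx /Sstack col_mx0 trmx0 mul0mx tens0mx. Qed.

Lemma mcvg_Fmx (u1 : nat -> 'M[C]_(N1, LS)) (u2 : nat -> 'M[C]_(N2, LS)) a1 a2 :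
  mcvg u1 a1 -> mcvg u2 a2 -> mcvg (fun k => F (u1 k) (u2 k)) (F a1 a2).
Proof.
move=> ua1 ua2.
have uS : mcvg (fun k => (Sstack (u1 k) (u2 k))^T) (Sstack a1 a2)^T.
  move=> i j; rewrite mxE mxE; under eq_fun do rewrite mxE mxE.
  by case: fintype.split => l; [exact: ua1 | exact: ua2].
have uSC := mcvgM uS (mcvg_cst (Ctblk Ct1 Ct2)).
move=> i j; rewrite mxE; under eq_fun do rewrite mxE.
by apply: ccvgM; [exact: uSC | exact: ccvg_cst].
Qed.

(** The weight [C0mx] is G^H G, so cyclicity of the trace puts [G] on both sides of the error
    covariance (I - T F)(I - T F)^H + T K T^H. *)
Lemma eRr_mse T S1 S2 : eRr Ct1 Ct2 Cr Kq Kr T S1 S2 = err T (F S1 S2).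
Proof.
rewrite /eRr /eR /mse rdot.unlock -ReD -mxtraceD; congr (complex.Re _).
have -> : C0mx Ct1 Ct2 Cr = hconj G *m G by rewrite hconj_tens tensmx_mul.
rewrite -mulmxA mxtrace_mulC; congr (\tr _).
move: (F S1 S2) => f.
have -> : 1%:M - hconj f *m hconj T - T *m f + T *m f *m hconj f *m hconj T +
    T *m K *m hconj T =
    (1%:M - T *m f) *m hconj (1%:M - T *m f) + T *m K *m hconj T.
  rewrite hconjB hconj1 hconjM mulmxBr mulmx1 mulmxBl mul1mx !mulmxA.
  congr (_ + _); rewrite opprB addrA.
  by rewrite (addrAC _ (- (hconj f *m hconj T)))
    (addrAC _ (- (hconj f *m hconj T))).
by move: (1%:M - T *m f) => E; rewrite mulmxDr mulmxDl !hconjM !mulmxA.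
Qed.

Lemma Tlmmse_normal_eq S1 S2 : herm_posdef K ->
  Tlmmse Ct1 Ct2 Cr Kq Kr S1 S2 *m (F S1 S2 *m hconj (F S1 S2) + K) =
  hconj (F S1 S2).
Proof. by move=> Kpd; rewrite /Tlmmse mulmxKV // gram_add_posdef_unit. Qed.

(** Varying one block with the other fixed gives each multiplier separately. Linearity of the
    first-order term recombines the blocks, and the normal equations take care of the direction
    [dT]. *)
Lemma KKT_of_alternating_min (tau1 tau2 : R) T S1 S2 :
  herm_posdef K -> 0 < tau1 -> 0 < tau2 ->
  feasible tau1 tau2 S1 S2 ->
  T *m (F S1 S2 *m hconj (F S1 S2) + K) = hconj (F S1 S2) ->
  (forall S1' S2', feasible tau1 tau2 S1' S2' ->
    err T (F S1 S2) <= err T (F S1' S2')) ->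
  KKT_point Ct1 Ct2 Cr Kq Kr tau1 tau2 T S1 S2.
Proof.
move=> Kpd tau1_gt0 tau2_gt0 [S1tau S2tau] TA Smin; split => //.
pose D (dF : 'M[C]_(LS * M, (N1 + N2) * M)) : R :=
   - 2 * rdot (G *m (1%:M - T *m F S1 S2)) (G *m T *m dF).
have DD (x y : 'M[C]_(LS * M, (N1 + N2) * M)) : D (x + y) = D x + D y.
  by rewrite /D (mulmxDr (G *m T)) rdotDr mulrDr.
have DZ (t : R) (x : 'M[C]_(LS * M, (N1 + N2) * M)) : D (t%:C%C *: x) = t * D x.
  by rewrite /D -scalemxAr rdotZr mulrCA.
pose e (dF : 'M[C]_(LS * M, (N1 + N2) * M)) : R :=
   rdot (G *m T *m dF) (G *m T *m dF).
have lineF (dF : 'M[C]_(LS * M, (N1 + N2) * M)) (t : R) :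
    err T (F S1 S2 + t%:C%C *: dF) - err T (F S1 S2) =
    D dF * t + e dF * t ^+ 2.
  by rewrite mse_line_F /D /e; ring.
have FD1 (x y : 'M[C]_(N1, LS)) :
    F (x + y) 0 = F x 0 + F y (0 : 'M[C]_(N2, LS)).
  by have := Fmx_linel 1 x y 0; rewrite !scale1r.
have FZ1 c (x : 'M[C]_(N1, LS)) : F (c *: x) 0 = c *: F x (0 : 'M[C]_(N2, LS)).
  by have := Fmx_linel c 0 x 0; rewrite Fmx0 !add0r.
have FD2 (x y : 'M[C]_(N2, LS)) :
    F 0 (x + y) = F 0 x + F (0 : 'M[C]_(N1, LS)) y.
  by have := Fmx_liner 1 0 x y; rewrite !scale1r.
have FZ2 c (x : 'M[C]_(N2, LS)) : F 0 (c *: x) = c *: F (0 : 'M[C]_(N1, LS)) x.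
  by have := Fmx_liner c 0 0 x; rewrite Fmx0 !add0r.
have [||d t dtau|mu1 [mu1_ge0 slack1 stat1]] := @ball_multiplier R _ _ S1 tau1
  (fun d => D (F d 0)) (fun d => e (F d 0)) tau1_gt0 S1tau.
- by move=> x y; rewrite FD1 DD.
- by move=> t x; rewrite FZ1 DZ.
- by rewrite -lineF subr_ge0 -Fmx_linel; exact: Smin.
have [||d t dtau|mu2 [mu2_ge0 slack2 stat2]] := @ball_multiplier R _ _ S2 tau2
  (fun d => D (F 0 d)) (fun d => e (F 0 d)) tau2_gt0 S2tau.
- by move=> x y; rewrite FD2 DD.
- by move=> t x; rewrite FZ2 DZ.
- by rewrite -lineF subr_ge0 -Fmx_liner; exact: Smin.
exists mu1, mu2; split=> //; split=> //; split=> //; split=> // dT dS1 dS2.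
have [P [P'0 PE]] := mse_line G Kpd dT (F dS1 dS2) TA.
rewrite -/(D _) in P'0; clearbody D.
(* The penalised constraint along a line, as a polynomial: the whole Lagrangian then becomes the
   polynomial [Q], whose derivative at 0 is read off its coefficients. *)
pose B N mu tau (S dS : 'M[C]_(N, LS)) : {poly R} :=
  (mu * (rdot S S - tau))%:P + (2 * mu * rdot S dS)%:P * 'X +
  (mu * rdot dS dS)%:P * 'X ^+ 2.
have BE N mu tau (S dS : 'M[C]_(N, LS)) t :
    (B N mu tau S dS).[t] = mu * (pow_tr (S + t%:C%C *: dS) - tau).
  rewrite !(hornerD, hornerM, hornerC, hornerXn, hornerX) pow_trE.
  by rewrite rdotDl !rdotDr rdotZl !rdotZr rdotZl (rdotC dS S); ring.
have B'0 N mu tau (S dS : 'M[C]_(N, LS)) :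
    (B N mu tau S dS)^`().[0] = 2 * mu * rdot S dS.
  by rewrite !poly.derivE !hornerE /=; ring.
pose Q := P + B _ mu1 tau1 S1 dS1 + B _ mu2 tau2 S2 dS2.
rewrite [X in is_derive _ _ X](_ : _ = horner Q); last first.
  apply/funext => t /=; rewrite eRr_mse Fmx_line PE.
  by rewrite /Q (hornerD (P + _)) (hornerD P) !BE.
apply: is_derive_eq.
rewrite /Q (derivD (P + _)) (derivD P) (hornerD (_ + _))
  (hornerD P^`()) P'0 !B'0.
(* Splitting the direction by blocks lets each half of the slope cancel against its own multiplier
   term. *)
have -> : F dS1 dS2 = F dS1 0 + F 0 dS2.
  by have := Fmx_line 1 dS1 0 0 dS2; rewrite !scale1r addr0 add0r.
rewrite DD -(stat1 dS1) -[RHS]addr0 -(stat2 dS2); ring.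
Qed.

End TwoWayRelay.

(** * Monotone convergence of the objective and stationarity of limit points *)

Theorem theorem1 (R : realType) (N1 N2 M LS : nat)
  (Zt1 Ct1 : 'M[R[i]]_N1) (Zt2 Ct2 : 'M[R[i]]_N2) (Zr Cr : 'M[R[i]]_M)
  (Kq : 'M[R[i]]_LS) (Kr : 'M[R[i]]_M) (tau1 tau2 : R)
  (hZt1 : herm_posdef Zt1) (hCt1 : Zt1 = Ct1 *m hconj Ct1)
  (hZt2 : herm_posdef Zt2) (hCt2 : Zt2 = Ct2 *m hconj Ct2)
  (hZr : herm_posdef Zr) (hCr : Zr = Cr *m hconj Cr)
  (hKR : herm_posdef (KRmx Kq Kr))
  (htau1 : 0 < tau1) (htau2 : 0 < tau2)
  (Ts : nat -> 'M[R[i]]_((N1 + N2) * M, LS * M))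
  (S1s : nat -> 'M[R[i]]_(N1, LS)) (S2s : nat -> 'M[R[i]]_(N2, LS))
  (hinit : feasible tau1 tau2 (S1s 0%N) (S2s 0%N))
  (hstepT : forall k : nat, Ts k = Tlmmse Ct1 Ct2 Cr Kq Kr (S1s k) (S2s k))
  (hstepS : forall k : nat,
     feasible tau1 tau2 (S1s k.+1) (S2s k.+1) /\
     forall (S1 : 'M[R[i]]_(N1, LS)) (S2 : 'M[R[i]]_(N2, LS)),
       feasible tau1 tau2 S1 S2 ->
       eRr Ct1 Ct2 Cr Kq Kr (Ts k) (S1s k.+1) (S2s k.+1)
         <= eRr Ct1 Ct2 Cr Kq Kr (Ts k) S1 S2) :
  (forall k : nat,
     eRr Ct1 Ct2 Cr Kq Kr (Ts k.+1) (S1s k.+1) (S2s k.+1)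
       <= eRr Ct1 Ct2 Cr Kq Kr (Ts k) (S1s k) (S2s k)) /\
  (exists l : R,
     (fun k : nat => eRr Ct1 Ct2 Cr Kq Kr (Ts k) (S1s k) (S2s k)) @ \oo --> l) /\
  (forall (Tb : 'M[R[i]]_((N1 + N2) * M, LS * M))
          (S1b : 'M[R[i]]_(N1, LS)) (S2b : 'M[R[i]]_(N2, LS)),
     iterates_limit_point Ts S1s S2s Tb S1b S2b ->
     KKT_point Ct1 Ct2 Cr Kq Kr tau1 tau2 Tb S1b S2b).
Proof.
have feas k : feasible tau1 tau2 (S1s k) (S2s k).
  by case: k => [//|k]; exact: (hstepS k).1.
pose G := Ctblk Ct1 Ct2 *t Cr; pose K := KRmx Kq Kr.
pose F := @Fmx R N1 N2 M LS Ct1 Ct2 Cr.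
pose V k := eRr Ct1 Ct2 Cr Kq Kr (Ts k) (S1s k) (S2s k).
have normal k : Ts k *m (F (S1s k) (S2s k) *m hconj (F (S1s k) (S2s k)) + K) =
    hconj (F (S1s k) (S2s k)).
  by rewrite hstepT Tlmmse_normal_eq.
have Tstep k T : V k <= eRr Ct1 Ct2 Cr Kq Kr T (S1s k) (S2s k).
  by rewrite /V !eRr_mse; apply: lmmse_min.
(* The middle value is the error of the old estimator at the new training; the old training, being
   feasible, is a competitor in the second half-step. *)
have Vstep k : V k.+1 <= V k.
  by apply: le_trans (Tstep k.+1 (Ts k)) _; exact: (hstepS k).2.
have Vdecr : nonincreasing_seq V by apply/nonincreasing_seqP.
split=> //; split.
  have Vcvg : cvgn V.
    apply: nonincreasing_is_cvgn => //; exists 0 => _ [k _ <-].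
    by rewrite /V eRr_mse mse_ge0.
  by exists (limn V).
move=> Tb S1b S2b limb.
(* The choice [s] need not be increasing: s n >= n suffices below. The tolerance is the one
   [mcvg_fro2] asks for. *)
have /choice[s hs] : forall n, exists k, (n <= k)%N /\
    fro2 (Ts k - Tb) + fro2 (S1s k - S1b) + fro2 (S2s k - S2b)
      < harmonic n ^+ 2.
  by move=> n; apply: limb; rewrite exprn_gt0 // harmonic_gt0.
have cvgT : mcvg (Ts \o s) Tb.
  apply: mcvg_fro2 => n; have [_ /ltW] := hs n; apply: le_trans => /=.
  by rewrite -addrA lerDl addr_ge0 ?fro2_ge0.
have cvgS1 : mcvg (S1s \o s) S1b.
  apply: mcvg_fro2 => n; have [_ /ltW] := hs n; apply: le_trans => /=.
  by rewrite addrAC lerDr addr_ge0 ?fro2_ge0.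
have cvgS2 : mcvg (S2s \o s) S2b.
  apply: mcvg_fro2 => n; have [_ /ltW] := hs n; apply: le_trans => /=.
  by rewrite lerDr addr_ge0 ?fro2_ge0.
have cvgF := mcvg_Fmx Ct1 Ct2 Cr cvgS1 cvgS2.
(* For n >= k monotonicity gives V (s n) <= V k, and the left side tends to the error at the limit
   point. *)
have Vb_le k : mse G K Tb (F S1b S2b) <= V k.
  apply: (cvgr_to_le (cvg_mse cvgT cvgF)).
  near=> n; rewrite /= -eRr_mse; apply: Vdecr.
  by apply: leq_trans (hs n).1; near: n; exact: nbhs_infty_ge.
apply: (KKT_of_alternating_min hKR htau1 htau2).
- split; rewrite pow_trE.
    apply: (cvgr_to_le (cvg_rdot cvgS1 cvgS1)); apply: nearW => n.
    by rewrite -pow_trE; exact: (feas _).1.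
  apply: (cvgr_to_le (cvg_rdot cvgS2 cvgS2)); apply: nearW => n.
  by rewrite -pow_trE; exact: (feas _).2.
(* The normal equations are polynomial in [T], [F] and F^H, so they pass to the limit with no appeal
   to continuity of the inverse. *)
- apply: (mcvg_unique _ (mcvg_hconj cvgF)).
  under eq_fun do rewrite /= -normal.
  apply: mcvgM => //; apply: mcvgD; last exact: mcvg_cst.
  by apply: mcvgM => //; exact: mcvg_hconj.
move=> S1 S2 feasS.
apply: (cvgr_to_ge (cvg_mse cvgT (mcvg_cst (F S1 S2)))); apply: nearW => n /=.
(* The iterate after s n may lie off the subsequence, but [Vb_le] bounds every iterate. Its training
   minimises the error for the estimator [Ts (s n)], which tends to [Tb], while the competitor [S1],
   [S2] stays fixed. *)
apply: le_trans (Vb_le (s n).+1) _.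
apply: le_trans (Tstep (s n).+1 (Ts (s n))) _.
by rewrite -eRr_mse; exact: (hstepS (s n)).2.
Unshelve. all: by end_near. Qed.
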